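(* If each new threshold $s$ is selected to be the median of the set of choices, then incremental topological ordering by soft-threshold search takes $\mathrm{O}(m^{3/2})$ total time over $m$ arc additions.
   Context: Incremental setting: a fixed set of $n$ vertices, initially no arcs; $m$ distinct arcs are added one at a time, with $m=\Omega(n)$; processing stops once a cycle is detected. A total order $<$ of the vertices, topological for the current graph, is maintained in a dynamic ordered list supporting order queries, deletions, and insertions just before/after a given element in $\mathrm{O}(1)$ amortized time; each vertex has singly linked outgoing and incoming arc lists; all sets below are doubly linked lists with membership flags; median selection takes linear time. When an arc $(v,w)$ is added: if $v<w$ do nothing; if $v>w$ run soft-threshold search (comparisons in the order before the addition): initialize $F=\{w\}$, $B=\{v\}$, $\mathit{out}(w)=$ first outgoing arc of $w$, $\mathit{in}(v)=$ first incoming arc of $v$ (null if none), $s=v$; $F_A=\{w\}$ if $\mathit{out}(w)\ne$ null else $\{\}$; $B_A=\{v\}$ if $\mathit{in}(v)\ne$ null else $\{\}$; $F_P=B_P=\{\}$. While $F_A\ne\{\}$ and $B_A\ne\{\}$: choose any $u\in F_A$, $z\in B_A$. If $u<z$: let $(u,x)=\mathit{out}(u)$, $(y,z)=\mathit{in}(z)$; advance $\mathit{out}(u)$, $\mathit{in}(z)$ to the next arcs on their lists (null if none); remove $u$ from $F_A$ if $\mathit{out}(u)$ is null and $z$ from $B_A$ if $\mathit{in}(z)$ is null; if $x\in B$ or $y\in F$, report a cycle and stop; if $x\notin F$, add $x$ to $F$, set $\mathit{out}(x)$ to its first outgoing arc and add $x$ to $F_A$ if non-null; if $y\notin B$, symmetrically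 with $\mathit{in}(y)$ and $B_A$. Otherwise: if $u>s$ move $u$ from $F_A$ to $F_P$; if $z<s$ move $z$ from $B_A$ to $B_P$. Then if $F_A=\{\}$: set $B_P=\{\}$, remove $s$ from $B_A$, and if $F_P\ne\{\}$ choose a new $s\in F_P$ (the set of choices is $F_P$) and move all $x\in F_P$ with $x\le s$ to $F_A$. If $B_A=\{\}$: set $F_P=\{\}$, remove $s$ from $F_A$, and if $B_P\ne\{\}$ choose a new $s\in B_P$ (the set of choices is $B_P$) and move all $x\in B_P$ with $x\ge s$ to $B_A$. If no cycle is reported, reorder: $t=\min(\{v\}\cup\{x\in F:\mathit{out}(x)\ne\text{null}\})$, $F_<=\{x\in F:x<t\}$, $B_>=\{y\in B:y>t\}$; if $t=v$ move $F_<$ just after $t$, else move $F_<$ just before $t$ and $B_>$ just before $F_<$; order each of $F_<$, $B_>$ internally topologically with a linear-time static algorithm.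
   Formalization: The cycle test ''x∈B or y∈F'' is corrected to ''x∈B or y∈F∪{x}'': as written, if x=y is new to both sides (arcs (w,x),(x,v), then (v,w)), the cycle is missed and the search loops forever; adding an arc with v=w, left unspecified, reports a cycle. *)

(* Defs.v *)
(* MathComp *)
From mathcomp Require Import all_boot.

Set Implicit Arguments.
Unset Strict Implicit.
Unset Printing Implicit Defensive.

(* Running time.  An execution emits the sequence of primitive operations it
   performs; the machine then spends some positive number of time units on each
   of them, subject to the bounds in [admissible]. *)

(* [Basic] stands for a bounded number of O(1) operations on arc lists, doubly
   linked sets and membership flags.  [ListOp] is an order query, a deletion or
   an insertion in the dynamic ordered list.  [Select k] is a selection by rank
   among k vertices, [TopSort k] a static topological sort of a graph whose
   vertices and arcs number k in total. *)
Inductive op := Basic | ListOp | Select of nat | TopSort of nat.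

(* The successor accounts for a constant overhead, also when k = 0. *)
Definition weight (o : op) : nat :=
  match o with Basic => 1 | ListOp => 1 | Select k => k.+1 | TopSort k => k.+1 end.

(* The comparisons made by [Select] are order queries, so that its linear bound
   is amortized together with the ordered list operations. *)
Definition amortized (o : op) : bool :=
  match o with ListOp | Select _ => true | _ => false end.

Definition timed_trace := seq (op * nat).

Definition total_time (tt : timed_trace) : nat := \sum_(p <- tt) p.2.

Definition admissible (c : nat) (tt : timed_trace) : Prop :=
  [/\ all (fun p => 0 < p.2) tt,
      all (fun p => amortized p.1 || (p.2 <= c * weight p.1)) tt
    & \sum_(p <- tt | amortized p.1) p.2
        <= c * \sum_(p <- tt | amortized p.1) weight p.1].

Section Algorithm.

Variable n : nat.
Notation V := 'I_n.
Implicit Types (ord : seq V) (S F B FA BA FP BP : {set V})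
               (u v w x y z : V).

(* A total order on the vertices is the list of all vertices, smallest first. *)
Definition before ord x y : bool := index x ord < index y ord.

Definition is_median ord S : pred V := fun s =>
  [&& s \in S,
      2 * #|[set x in S | before ord x s]| <= #|S|
    & 2 * #|[set x in S | before ord s x]| <= #|S| ].

(* [gout x] lists the heads of the arcs leaving x, [gin x] the tails of the
   arcs entering x. *)
Record graph := Graph {
  gord : seq V;
  gout : V -> seq V;
  gin  : V -> seq V }.

Definition insert_at (i : nat) x (s : seq V) : seq V := take i s ++ x :: drop i s.

(* The positions i and j at which the arc enters the two arc lists are left
   open: the paper does not fix them. *)
Definition add_arc (g : graph) v w (i j : nat) : graph :=
  Graph (gord g)
        [eta gout g with v |-> insert_at i w (gout g v)]
        [eta gin g with w |-> insert_at j v (gin g w)].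

(* [outp x] (resp. [inp x]) is the part of the arc list of x that starts at
   out(x) (resp. in(x)); the null pointer is the empty list.  These pointers are
   meaningful only on [fS] (resp. [bS]). *)
Record search := Search {
  fS : {set V};   (* F *)
  bS : {set V};   (* B *)
  fA : {set V};   (* F_A *)
  bA : {set V};   (* B_A *)
  fP : {set V};   (* F_P *)
  bP : {set V};   (* B_P *)
  outp : V -> seq V;
  inp  : V -> seq V;
  thr  : V }.     (* s *)

Definition if_arcs x (l : seq V) : {set V} := if nilp l then set0 else [set x].

Definition init_search (g : graph) v w : search :=
  {| fS := [set w]; bS := [set v];
     fA := if_arcs w (gout g w); bA := if_arcs v (gin g v);
     fP := set0; bP := set0;
     outp := [fun _ : V => [::] with w |-> gout g w];
     inp := [fun _ : V => [::] with v |-> gin g v];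
     thr := v |}.

Definition advance_out (g : graph) (st : search) u x (ou : seq V) : search :=
  let: Search F B FA BA FP BP o i s := st in
  let o1 := [eta o with u |-> ou] in
  let FA1 := if nilp ou then FA :\ u else FA in
  if x \in F then Search F B FA1 BA FP BP o1 i s
  else Search (x |: F) B (FA1 :|: if_arcs x (gout g x)) BA FP BP
              [eta o1 with x |-> gout g x] i s.

Definition advance_in (g : graph) (st : search) y z (iz : seq V) : search :=
  let: Search F B FA BA FP BP o i s := st in
  let i1 := [eta i with z |-> iz] in
  let BA1 := if nilp iz then BA :\ z else BA in
  if y \in B then Search F B FA BA1 FP BP o i1 s
  else Search F (y |: B) FA (BA1 :|: if_arcs y (gin g y)) FP BP
              o [eta i1 with y |-> gin g y] s.

Definition park ord (st : search) u z : search :=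
  let: Search F B FA BA FP BP o i s := st in
  let pu := before ord s u in
  let pz := before ord z s in
  Search F B (if pu then FA :\ u else FA) (if pz then BA :\ z else BA)
         (if pu then u |: FP else FP) (if pz then z |: BP else BP) o i s.

(* The part of an iteration that precedes the tests F_A = {} and B_A = {};
   [None] reports a cycle.  The arc (u, x) is processed before (y, z), so y is
   tested against x |: F: when x = y is a vertex new to both sides, u -> x -> z
   closes a cycle, and no later step would detect it. *)
Inductive body (g : graph) (st : search) : seq op -> option search -> Prop :=
| BodyCycle u z x y ou iz of
    u \in fA st & z \in bA st & before (gord g) u z &
    outp st u = x :: ou & inp st z = y :: iz &
    (x \in bS st) || (y \in x |: fS st) :
    body g st [:: ListOp; Basic] None
| BodyTraverse u z x y ou iz of
    u \in fA st & z \in bA st & before (gord g) u z &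
    outp st u = x :: ou & inp st z = y :: iz &
    ~~ ((x \in bS st) || (y \in x |: fS st)) :
    body g st [:: ListOp; Basic]
      (Some (advance_in g (advance_out g st u x ou) y z iz))
| BodyPark u z of
    u \in fA st & z \in bA st & ~~ before (gord g) u z :
    body g st [:: ListOp; ListOp; ListOp; Basic] (Some (park (gord g) st u z)).

(* [pick ord S s]: the rule for selecting thresholds allows s when the set of
   choices is S. *)
Variable pick : seq V -> {set V} -> pred V.

(* Emptying a set costs one [Basic] per element, to reset membership flags. *)
Definition threshold_ops (emptied choices : {set V}) : seq op :=
  Basic :: nseq #|emptied| Basic ++
  Select #|choices| :: nseq #|choices| ListOp ++ nseq #|choices| Basic.

Inductive adjustF ord : search -> seq op -> search -> Prop :=
| AdjFSkip st of fA st != set0 : adjustF ord st [:: Basic] st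
| AdjFNone F B BA BP o i s :
    adjustF ord (Search F B set0 BA set0 BP o i s)
      (Basic :: nseq #|BP| Basic)
      (Search F B set0 (BA :\ s) set0 set0 o i s)
| AdjFThr F B BA FP BP o i s s' of s' \in FP & pick ord FP s' :
    adjustF ord (Search F B set0 BA FP BP o i s)
      (threshold_ops BP FP)
      (Search F B [set x in FP | ~~ before ord s' x] (BA :\ s)
              [set x in FP | before ord s' x] set0 o i s').

Inductive adjustB ord : search -> seq op -> search -> Prop :=
| AdjBSkip st of bA st != set0 : adjustB ord st [:: Basic] st
| AdjBNone F B FA FP o i s :
    adjustB ord (Search F B FA set0 FP set0 o i s)
      (Basic :: nseq #|FP| Basic)
      (Search F B (FA :\ s) set0 set0 set0 o i s)
| AdjBThr F B FA FP BP o i s s' of s' \in BP & pick ord BP s' :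
    adjustB ord (Search F B FA set0 FP BP o i s)
      (threshold_ops FP BP)
      (Search F B (FA :\ s) [set x in BP | ~~ before ord x s']
              set0 [set x in BP | before ord x s'] o i s').

(* Reordering after a search that reports no cycle. *)

Definition pivot ord (st : search) v : V :=
  [arg min_(x < v | (x == v) || ((x \in fS st) && ~~ nilp (outp st x)))
     index x ord].

Definition f_lt ord (st : search) t := [set x in fS st | before ord x t].
Definition b_gt ord (st : search) t := [set y in bS st | before ord t y].

Definition topo_list (g : graph) S (l : seq V) : Prop :=
  perm_eq l (enum S) /\
  {in S &, forall x y, y \in gout g x -> before l x y}.

Definition reorder ord v t (sF sB : seq V) : seq V :=
  if t == v then
    let rest := [seq x <- ord | x \notin sF] in
    let k := (index t rest).+1 in take k rest ++ sF ++ drop k rest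
  else
    let rest := [seq x <- ord | (x \notin sF) && (x \notin sB)] in
    let k := index t rest in take k rest ++ sB ++ sF ++ drop k rest.

(* Finding t and testing F and B against it; collecting the subgraphs induced by
   F_< and B_> from the outgoing, respectively incoming, arc lists; sorting both
   subgraphs; and one deletion and one insertion per moved vertex. *)
Definition reorder_ops (g : graph) (st : search) t : seq op :=
  let FL := f_lt (gord g) st t in
  let BG := b_gt (gord g) st t in
  let arcsF := \sum_(x in FL) size (gout g x) in
  let arcsB := \sum_(y in BG) size (gin g y) in
  let inF := \sum_(x in FL) count (mem FL) (gout g x) in
  let inB := \sum_(y in BG) count (mem BG) (gin g y) in
  Basic :: nseq (#|fS st| + #|bS st|) Basic ++
  nseq (2 * (#|fS st| + #|bS st|)) ListOp ++
  nseq (arcsF + arcsB) Basic ++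
  [:: TopSort (#|FL| + inF); TopSort (#|BG| + inB)] ++
  nseq (2 * (#|FL| + #|BG|)) ListOp.

(* The list of arcs holds the additions still to be made; in [Searching v w] the
   arc (v, w) is being added.  Adding a loop (v, v) reports a cycle at once. *)
Inductive config :=
| Idle of seq (V * V) & graph
| Searching of V & V & seq (V * V) & graph & search
| Halted.

Inductive step : config -> seq op -> config -> Prop :=
| AddForward v w arcs g i j of before (gord g) v w :
    step (Idle ((v, w) :: arcs) g) [:: Basic; ListOp]
         (Idle arcs (add_arc g v w i j))
| AddLoop v arcs g :
    step (Idle ((v, v) :: arcs) g) [:: Basic; ListOp] Halted
| AddBackward v w arcs g i j of before (gord g) w v :
    let g' := add_arc g v w i j in
    step (Idle ((v, w) :: arcs) g) [:: Basic; ListOp]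
         (Searching v w arcs g' (init_search g' v w))
| IterCycle v w arcs g st ops of
    fA st != set0 & bA st != set0 & body g st ops None :
    step (Searching v w arcs g st) (Basic :: ops) Halted
| IterNext v w arcs g st st1 st2 st3 ops1 ops2 ops3 of
    fA st != set0 & bA st != set0 & body g st ops1 (Some st1) &
    adjustF (gord g) st1 ops2 st2 & adjustB (gord g) st2 ops3 st3 :
    step (Searching v w arcs g st) (Basic :: ops1 ++ ops2 ++ ops3)
         (Searching v w arcs g st3)
| Finish v w arcs g st sF sB of
    (fA st == set0) || (bA st == set0) :
    let t := pivot (gord g) st v in
    topo_list g (f_lt (gord g) st t) sF ->
    topo_list g (b_gt (gord g) st t) sB ->
    step (Searching v w arcs g st) (reorder_ops g st t)
         (Idle arcs (Graph (reorder (gord g) v t sF sB) (gout g) (gin g))).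

(* Initially the ordered list is built by n insertions, and the arc lists and
   pointers of the n vertices are created. *)
Definition setup_ops : seq op := nseq n ListOp ++ nseq n Basic.

(* [run arcs ord tr q]: adding the arcs in sequence from the arcless graph with
   vertex order [ord] can lead to the (not necessarily final) configuration q,
   performing the operations tr.  As every step performs an operation, a bound
   on the time of all runs is also a bound on termination. *)
Inductive run (arcs : seq (V * V)) ord : seq op -> config -> Prop :=
| RunStart : run arcs ord setup_ops
               (Idle arcs (Graph ord (fun=> [::]) (fun=> [::])))
| RunStep tr q ops q' of run arcs ord tr q & step q ops q' :
    run arcs ord (tr ++ ops) q'.

End Algorithm.

(* Main.v *)
(** A search that makes k paired arc traversals costs O(1 + k): all other work,
    i.e. parking vertices and changing the threshold, is paid for by a potential
    that each traversal raises by O(1), because a median threshold leaves parked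
    about as many vertices as it reactivates.  When the search ends, no
    compatible pair of vertices has arcs left on both sides, so that reordering
    also costs O(1 + k) and yields a topological order.

    Call an ordered pair of arcs related if a path leads from the head of the
    first to the tail of the second.  The k forward and k backward arcs
    traversed by a search give at least k^2 / 2 newly related pairs, and at most
    m^2 pairs are ever related, so the sum of k^2 over all searches is O(m^2)
    and, by Cauchy-Schwarz, the sum of k is O(m^(3/2)). *)

Require Import Defs.
From mathcomp Require Import all_boot all_order all_algebra.
From mathcomp Require Import reals exp.
From mathcomp Require Import zify.
Import Order.TTheory GRing.Theory Num.Theory.

Set Implicit Arguments.
Unset Strict Implicit.
Unset Printing Implicit Defensive.

(** * The search and its potential *)

Section StrictOrder.

Variable V : eqType.

Record strict_total (lt : rel V) : Prop := StrictTotal {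
  strict_irr : irreflexive lt;
  strict_trans : transitive lt;
  strict_cmp : forall x y, [|| x == y, lt x y | lt y x] }.

Definition flip (lt : rel V) : rel V := fun x y => lt y x.

Lemma flip_strict_total lt : strict_total lt -> strict_total (flip lt).
Proof.
case=> i t c; split=> [x|y x z xy yz|x y]; rewrite /flip; first exact: i.
  exact: t yz xy.
by rewrite [lt y x || _]orbC.
Qed.

Lemma strict_asym lt x y : strict_total lt -> lt x y -> ~~ lt y x.
Proof. by case=> i t _ xy; apply/negP => /(t _ _ _ xy); rewrite i. Qed.

End StrictOrder.

(** * Invariants of a search, and the symmetry between its two sides *)

Section SearchInvariant.

Variable n : nat.
Notation V := 'I_n.

(** The order and the arc lists are parameters, so that the backward search is a forward search for
    the reversed order with the two families of lists exchanged. Only the arc (v, w) being added may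
    violate the order. *)
Record ambient (lt : rel V) (out inn : V -> seq V) (v w : V) : Prop := Ambient {
  amb_order : strict_total lt;
  amb_uout : forall x, uniq (out x);
  amb_uin : forall x, uniq (inn x);
  amb_mem : forall x y, (x \in inn y) = (y \in out x);
  amb_topo : forall x y, y \in out x -> (x, y) != (v, w) -> lt x y }.

Lemma ambient_mirror lt out inn v w :
  ambient lt out inn v w -> ambient (flip lt) inn out w v.
Proof.
case=> o uo ui m t; split=> // [|x y yx ne]; first exact: flip_strict_total.
apply: t; first by rewrite -m.
by apply: contra ne => /eqP[-> ->].
Qed.

(** One side of the search. The list [l], which exists only in the proof, records the arcs traversed
    so far, directed away from the root; [o x] is the part of the arc list of x still to be
    traversed. *)
Record half_inv (lt : rel V) (out : V -> seq V) (root : V) (F A P : {set V})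
    (o : V -> seq V) (s : V) (l : seq (V * V)) : Prop := HalfInv {
  h_root : root \in F;
  h_A : A \subset F;
  h_P : P \subset F;
  h_beyond : forall x, x \in P -> lt s x;
  h_ge : forall x, x \in F -> (x == root) || lt root x;
  h_conn : forall x, x \in F -> connect (grel out) root x;
  h_ouniq : forall x, x \in F -> uniq (o x);
  h_osub : forall x, x \in F -> {subset o x <= out x};
  h_mem : forall x y, ((x, y) \in l) = [&& x \in F, y \in out x & y \notin o x];
  h_head : forall x y, (x, y) \in l -> y \in F;
  h_uniq : uniq l;
  h_card : #|F| <= (size l).+1 }.

(** A vertex that has arcs left but is neither active nor parked was discarded. Discarding is
    harmless because such a vertex forms no compatible pair with a vertex of the other side that has
    arcs left. *)
Definition dead_beyond (lt : rel V) (F A P : {set V}) (o : V -> seq V)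
    (B : {set V}) (i : V -> seq V) : Prop :=
  forall x z, x \in F -> x \notin A -> x \notin P -> ~~ nilp (o x) ->
              z \in B -> ~~ nilp (i z) -> ~~ lt x z.

Record search_inv (lt : rel V) (out inn : V -> seq V) (v w : V) (st : search n)
    (l k : seq (V * V)) : Prop := SearchInv {
  s_F : half_inv lt out w (fS st) (fA st) (fP st) (outp st) (thr st) l;
  s_B : half_inv (flip lt) inn v (bS st) (bA st) (bP st) (inp st) (thr st) k;
  s_dis : forall x, x \in fS st -> x \notin bS st;
  s_dF : dead_beyond lt (fS st) (fA st) (fP st) (outp st) (bS st) (inp st);
  s_dB : dead_beyond (flip lt) (bS st) (bA st) (bP st) (inp st)
                     (fS st) (outp st) }.

(** Each move is analysed on the forward side only; its backward counterpart is obtained through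
    this exchange. *)
Definition mirror (st : search n) : search n :=
  Search (bS st) (fS st) (bA st) (fA st) (bP st) (fP st) (inp st) (outp st)
         (thr st).

Definition mirror_graph (g : graph n) : graph n :=
  Graph (gord g) (gin g) (gout g).

Lemma mirrorK : involutive mirror.
Proof. by case. Qed.

Lemma search_inv_mirror lt out inn v w st l k :
  search_inv lt out inn v w st l k ->
  search_inv (flip lt) inn out w v (mirror st) k l.
Proof.
case=> hF hB d dF dB; split=> //= x xB; apply/negP => xF.
by move: (d x xF); rewrite xB.
Qed.

(* A vertex of A weighs 4 and a vertex of P weighs 3, but a vertex of A before
   the threshold is matched, if possible, with one of P, and each such pair has
   a rebate of 2.  A median threshold turns P into such pairs.  When the
   threshold moves the other way, the loss of P pays for the lost rebates.  The
   threshold itself, which is discarded at that moment, weighs nothing. *)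
Definition half_potential (lt : rel V) (A P : {set V}) (s : V) : nat :=
  4 * #|A :\ s| + (3 * #|P| - 2 * minn #|[set x in A | lt x s]| #|P|).

Definition potential (lt : rel V) (st : search n) : nat :=
  half_potential lt (fA st) (fP st) (thr st) +
  half_potential (flip lt) (bA st) (bP st) (thr st).

Lemma potential_mirror lt st : potential (flip lt) (mirror st) = potential lt st.
Proof. by rewrite /potential addnC. Qed.

Lemma advance_in_mirror g st y z iz :
  mirror (advance_in g st y z iz) =
  advance_out (mirror_graph g) (mirror st) z y iz.
Proof. by case: st => *; rewrite /advance_in /advance_out /=; case: ifP. Qed.

(** A parked vertex weighs 3 and carries a rebate of at most 2, so emptying P frees at least 1 per
    vertex, even though all rebates are lost. *)
Lemma half_potential_discard (lt : rel V) (A P : {set V}) s s' :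
  half_potential lt (A :\ s) set0 s' + #|P| <= half_potential lt A P s.
Proof.
rewrite /half_potential cards0.
have := subset_leq_card (subsetDl (A :\ s) [set s']).
move: #|_| #|_| #|_| #|_| #|_|; lia.
Qed.

(* lia may fail on cardinals that are not generalized first. *)
Ltac card_lia :=
  rewrite /=; repeat move: (half_potential _ _ _ _) => ?;
  repeat move: (potential _ _) => ?;
  repeat move: #|_| => ?; lia.

(** * Effect of each move on the invariant and the potential *)

Section Moves.

Variables (lt : rel V) (g : graph n) (v w : V).
Hypothesis amb : ambient lt (gout g) (gin g) v w.

(** A new active vertex adds at most 4. Removing u may cost a rebate of 2, but then u precedes s,
    hence differs from s, and its weight 4 is released. *)
Lemma half_potential_advance (A : {set V}) P s u x (b1 b2 : bool) :
  half_potential lt ((if b1 then A :\ u else A) :|: if b2 then set0 else [set x]) P s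
    <= half_potential lt A P s + 4.
Proof.
set A1 := (if b1 then _ else _); set A2 := (if b2 then _ else _).
have c2 : #|A2| <= 1 by rewrite /A2; case: (b2); rewrite ?cards0 ?cards1.
have e1 : #|A1 :\ s| + (b1 && (u \in A :\ s)) = #|A :\ s|.
  rewrite /A1; case: (b1) => /=; last by rewrite addn0.
  by rewrite [RHS](cardsD1 u) addnC setDDl setUC -setDDl.
have e2 : #|[set x0 in A1 | lt x0 s]| + (b1 && (u \in [set x in A | lt x s])) =
          #|[set x in A | lt x s]|.
  rewrite /A1; case: (b1) => /=; last by rewrite addn0.
  rewrite [RHS](cardsD1 u) addnC; congr (_ + _).
  by apply: eq_card => y; rewrite !inE andbA.
have lo : (u \in [set x in A | lt x s]) <= (u \in A :\ s).
  rewrite !inE; have [->|] := eqVneq u s; last by case: (u \in A); case: (lt u s).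
  by rewrite (strict_irr (amb_order amb)) andbF.
have c3 : #|(A1 :|: A2) :\ s| <= #|A1 :\ s| + 1.
  rewrite setDUl (leq_trans (leq_card_setU _ _)) // leq_add2l.
  by rewrite (leq_trans (subset_leq_card (subsetDl _ _))).
have c4 : #|[set x0 in A1 | lt x0 s]| <= #|[set x0 in A1 :|: A2 | lt x0 s]|.
  by apply/subset_leq_card/subsetP => y; rewrite !inE => /andP[-> ->].
have lo1 : (b1 && (u \in [set x in A | lt x s])) <= (b1 && (u \in A :\ s)).
  by case: (b1).
rewrite /half_potential; move: lo1 e1 e2 c3 c4.
move: (nat_of_bool _) (nat_of_bool _) => d1 d2.
move: #|_| #|_| #|_| #|_| #|_| #|_| #|_|; lia.
Qed.

Lemma advance_out_inv st l k u x ou :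
  search_inv lt (gout g) (gin g) v w st l k ->
  u \in fA st -> outp st u = x :: ou -> x \notin bS st ->
  search_inv lt (gout g) (gin g) v w (advance_out g st u x ou) ((u, x) :: l) k
  /\ potential lt (advance_out g st u x ou) <= potential lt st + 4.
Proof.
case: st => F B FA BA FP BP o i s [/= hF hB dis dF dB] uA ou_def xB.
have uF : u \in F by apply: (subsetP (h_A hF)).
have xou : x \notin ou by have := h_ouniq hF uF; rewrite ou_def => /andP[].
have uou : uniq ou by have := h_ouniq hF uF; rewrite ou_def => /andP[].
have xo : x \in gout g u by apply: (h_osub hF uF); rewrite ou_def mem_head.
(* As v lies in B, which is disjoint from F, the arc (u, x) is not the new arc and therefore
   respects the order. *)
have uv : u != v by apply: contraTneq (h_root hB) => <-; exact: dis.
have ux : lt u x by apply: (amb_topo amb) => //; apply: contra uv => /eqP[->].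
have ltt := strict_trans (amb_order amb).
have wx : (x == w) || lt w x.
  by case/orP: (h_ge hF uF) => [/eqP<-|/ltt->]; rewrite ?ux ?orbT.
have cx : connect (grel (gout g)) w x.
  by apply: connect_trans (h_conn hF uF) (connect1 _).
have nul : (u, x) \notin l by rewrite (h_mem hF) ou_def mem_head !andbF.
have [xF|/negbTE xF] := boolP (x \in F); rewrite /advance_out /=.
  split; last first.
    rewrite /potential /=; have := half_potential_advance FA FP s u x (nilp ou) true.
    by rewrite /= setU0 addnAC leq_add2r.
  split=> //=.
  - split=> //=; try by case: hF.
    + by case: ifP => _; rewrite ?(subset_trans (subsetDl _ _)) ?(h_A hF).
    + by move=> y yF /=; case: (eqVneq y u) => // _; apply: (h_ouniq hF).
    + move=> y yF /=; case: (eqVneq y u) => [->|_]; last exact: (h_osub hF).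
      by move=> a au; apply: (h_osub hF uF); rewrite ou_def inE au orbT.
    + move=> a b; rewrite inE (h_mem hF) xpair_eqE.
      case: (eqVneq a u) => [->|_] //=; rewrite uF ou_def inE /=.
      by case: (eqVneq b x) => [->|_] //=; rewrite xo xou.
    + by move=> a b; rewrite inE => /orP[/eqP[_ ->]|/(h_head hF)].
    + by rewrite nul (h_uniq hF).
    + exact: leq_trans (h_card hF) _.
  - move=> a z aF /=; case: (eqVneq a u) => [->|au].
      by move: uA; case: (nilp ou) => //= ->.
    move=> aA; apply: dF => //.
    by move: aA; case: ifP => //; rewrite !inE au.
  - move=> z a zB zA zP iz aF /=; case: (eqVneq a u) => [->|_]; last exact: dB.
    by move=> _; apply: dB; rewrite // ou_def.
have xu : x != u by apply: contraFneq xF => ->.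
split; last first.
  rewrite /potential /=.
  have := half_potential_advance FA FP s u x (nilp ou) (nilp (gout g x)).
  by rewrite /if_arcs addnAC leq_add2r.
split=> /=.
- split=> //=; try by case: hF.
  + by rewrite !inE (h_root hF) orbT.
  + rewrite subUset /if_arcs; apply/andP; split.
      apply: subset_trans (subsetUr _ _).
      by case: ifP => _; rewrite ?(subset_trans (subsetDl _ _)) ?(h_A hF).
    by case: ifP => _; rewrite ?sub0set // sub1set !inE eqxx.
  + exact: subset_trans (h_P hF) (subsetUr _ _).
  + by move=> y; rewrite !inE => /orP[/eqP->//|/(h_ge hF)].
  + by move=> y; rewrite !inE => /orP[/eqP->//|/(h_conn hF)].
  + move=> y; rewrite !inE; case: (eqVneq y x) => [->|_ /= yF].
      by rewrite (amb_uout amb).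
    by case: (eqVneq y u) => // _; apply: (h_ouniq hF).
  + move=> y; rewrite !inE; case: (eqVneq y x) => [-> _ a //|_ /= yF].
    case: (eqVneq y u) => [->|_]; last exact: (h_osub hF).
    by move=> a au; apply: (h_osub hF uF); rewrite ou_def inE au orbT.
  + move=> a b; rewrite !inE (h_mem hF) xpair_eqE.
    case: (eqVneq a x) => [->|ax] /=.
      by rewrite xF (negPf xu) /= andbN.
    case: (eqVneq a u) => [->|_] //=; rewrite uF ou_def inE /=.
    by case: (eqVneq b x) => [->|_] //=; rewrite xo xou.
  + move=> a b; rewrite !inE => /orP[/eqP[_ ->]|/(h_head hF)->].
      by rewrite eqxx.
    by rewrite orbT.
  + by rewrite nul (h_uniq hF).
  + by rewrite cardsU1 xF /= add1n ltnS (h_card hF).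
- exact: hB.
- by move=> y; rewrite !inE => /orP[/eqP->//|/dis].
- move=> a z /=; rewrite !inE negb_or; case: (eqVneq a x) => [->|ax] /= aF.
    rewrite /if_arcs => /andP[_ h] _ nx; move: h.
    by rewrite (negPf nx) inE eqxx.
  case: (eqVneq a u) => [->|au].
    by move=> /andP[h _]; move: h uA; case: (nilp ou) => //= /negPf->.
  move=> /andP[aA _]; apply: dF => //.
  by move: aA; case: ifP => //; rewrite !inE au.
- move=> z a zB zA zP iz /=; rewrite !inE; case: (eqVneq a x) => [->|ax] /= aF.
    (* A discarded z is not after u, which had an arc left; since x comes after u, z is not after x
       either. *)
    move=> _; have: ~~ lt u z by apply: (dB z u) => //; rewrite ou_def.
    by apply: contra => /(ltt _ _ _ ux).
  case: (eqVneq a u) => [->|_]; last exact: dB.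
  by move=> _; apply: dB; rewrite // ou_def.
Qed.

(** The forward half of [park], for an arbitrary order, so that its mirror image is the backward
    half. *)
Definition park_out (st : search n) u : search n :=
  let: Search F B FA BA FP BP o i s := st in
  Search F B (if lt s u then FA :\ u else FA) BA
         (if lt s u then u |: FP else FP) BP o i s.

(** A parked vertex drops from weight 4 to 3. It was after s, so the active vertices before s are
    unchanged, and a larger P can only increase the rebate. *)
Lemma park_out_inv st l k u :
  search_inv lt (gout g) (gin g) v w st l k -> u \in fA st ->
  search_inv lt (gout g) (gin g) v w (park_out st u) l k /\
  potential lt (park_out st u) + lt (thr st) u <= potential lt st.
Proof.
case: st => F B FA BA FP BP o i s inv uA; move: (inv) uA.
case=> [/= hF hB dis dF dB] uA; rewrite /park_out.
case: ifP => su; last by rewrite addn0.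
have us := negbTE (strict_asym (amb_order amb) su).
have uns : u != s by apply: contraTneq su => ->; rewrite (strict_irr (amb_order amb)).
split; last first.
  rewrite /potential /= addnAC leq_add2r /half_potential.
  have -> : [set x in FA :\ u | lt x s] = [set x in FA | lt x s].
    by apply/setP=> x; rewrite !inE; case: (eqVneq x u) => // ->; rewrite us !andbF.
  have := cardsD1 u (FA :\ s); rewrite !inE uns uA /= setDDl setUC -setDDl.
  have := cardsU1 u FP; have := leq_b1 (u \notin FP); move: (nat_of_bool _).
  move: #|_| #|_| #|_| #|_| #|_|; lia.
split=> //=.
- split=> //=; try by case: hF.
  + exact: subset_trans (subsetDl _ _) (h_A hF).
  + by rewrite subUset sub1set (subsetP (h_A hF)) //= (h_P hF).
  + by move=> x; rewrite !inE => /orP[/eqP->//|/(h_beyond hF)].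
- move=> x z xF; rewrite !inE negb_and negbK negb_or.
  by case: (eqVneq x u) => //= _; apply: dF.
Qed.

(* An emptied side strands every vertex of the other side that is parked or
   equal to the threshold, as these lie on the far side of all live vertices. *)
Lemma discard_inv F B FA BA FP BP o i s l k :
  search_inv lt (gout g) (gin g) v w (Search F B FA BA FP BP o i s) l k ->
  FA = set0 ->
  search_inv lt (gout g) (gin g) v w (Search F B set0 (BA :\ s) FP set0 o i s) l k.
Proof.
move=> [/= hF hB dis dF dB] FA0; move: FA0 hF dF => -> hF dF.
have [irr ltt tot] := amb_order amb.
split=> //=.
  split=> //=; try by case: hB.
  - exact: subset_trans (subsetDl _ _) (h_A hB).
  - exact: sub0set.
  - by move=> x; rewrite inE.
move=> z x zB; rewrite !inE negb_and negbK => zA _ iz xF ox.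
have [xP|xP] := boolP (x \in FP); last by apply: dF; rewrite ?inE.
have sx := h_beyond hF xP.
case/orP: zA => [/eqP->|zA]; first exact: strict_asym (amb_order amb) sx.
have [zP|zP] := boolP (z \in BP); last exact: dB.
by apply: (strict_asym (amb_order amb)); apply: ltt sx; apply: (h_beyond hB).
Qed.

(** The old P is divided between the new A and the new P, so no vertex is discarded. *)
Lemma threshold_inv F B BA FP o i s l k s' :
  search_inv lt (gout g) (gin g) v w (Search F B set0 BA FP set0 o i s) l k ->
  s' \in FP ->
  search_inv lt (gout g) (gin g) v w
    (Search F B [set x in FP | ~~ lt s' x] BA [set x in FP | lt s' x] set0 o i s')
    l k.
Proof.
move=> [/= hF hB dis dF dB] s'P.
split=> //=.
- split=> //=; try by case: hF.
  + by apply/subsetP => x; rewrite inE => /andP[/(subsetP (h_P hF))].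
  + by apply/subsetP => x; rewrite inE => /andP[/(subsetP (h_P hF))].
  + by move=> x; rewrite inE => /andP[].
- by split=> //=; try (by case: hB); move=> x; rewrite inE.
- move=> x z xF; rewrite !inE => xA xP; apply: dF => //; rewrite ?inE //.
  by move: xA xP; case: (x \in FP); case: (lt s' x).
Qed.

(** The median splits the other choices into two parts whose sizes differ by at most 1. A
    reactivated vertex matched with a parked one weighs 4 + 3 - 2 = 5 together, against 6 before, so
    about half a unit per choice is freed. *)
Lemma threshold_potential (FP : {set V}) s s' :
  s' \in FP ->
  2 * #|[set x in FP | lt x s']| <= #|FP| ->
  2 * #|[set x in FP | lt s' x]| <= #|FP| ->
  2 * half_potential lt [set x in FP | ~~ lt s' x] [set x in FP | lt s' x] s'
    + #|FP| + 2 <= 2 * half_potential lt set0 FP s.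
Proof.
move=> s'P med1 med2; rewrite /half_potential set0D cards0.
have [irr ltt tot] := amb_order amb.
have -> : [set x in [set x in FP | ~~ lt s' x] | lt x s'] = [set x in FP | lt x s'].
  apply/setP=> x; rewrite !inE -andbA; congr (_ && _).
  by case h: (lt x s'); rewrite ?andbF ?andbT // (strict_asym (amb_order amb)).
have -> : [set x in FP | ~~ lt s' x] :\ s' = [set x in FP | lt x s'].
  apply/setP=> x; rewrite !inE; case: (eqVneq x s') => [->|ne] /=.
    by rewrite irr andbF.
  congr (_ && _); have := tot x s'; rewrite (negPf ne) /=.
  case h: (lt x s') => /=; first by rewrite (strict_asym (amb_order amb)).
  by move->.
have -> : [set x in set0 | lt x s] = set0 :> {set V}.
  by apply/setP=> x; rewrite !inE.
have := cardsD1 s' FP; rewrite s'P.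
have -> : FP :\ s' = [set x in FP | lt x s'] :|: [set x in FP | lt s' x].
  apply/setP=> x; rewrite !inE; case: (eqVneq x s') => [->|ne] /=.
    by rewrite irr andbF.
  have := tot x s'; rewrite (negPf ne) -andb_orr /= => ->.
  by rewrite andbT.
rewrite cardsU (_ : _ :&: _ = set0) ?cards0; last first.
  apply/setP=> x; rewrite !inE; case h: (lt x s'); rewrite ?andbF //.
  by rewrite (negPf (strict_asym (amb_order amb) h)) !andbF.
move: med1 med2; move: #|_| #|_| #|_| => /=; lia.
Qed.

Lemma close_inv F B BA BP o i s l k :
  let st := Search F B set0 BA set0 BP o i s in
  let st' := Search F B set0 (BA :\ s) set0 set0 o i s in
  search_inv lt (gout g) (gin g) v w st l k ->
  search_inv lt (gout g) (gin g) v w st' l k /\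
  potential lt st' + #|BP| <= potential lt st.
Proof.
move=> st st' inv; split; first exact: discard_inv inv _.
by rewrite /potential /= -addnA leq_add2l half_potential_discard.
Qed.

Lemma retarget_inv F B BA FP BP o i s s' l k :
  let st := Search F B set0 BA FP BP o i s in
  let st' := Search F B [set x in FP | ~~ lt s' x] (BA :\ s)
                    [set x in FP | lt s' x] set0 o i s' in
  search_inv lt (gout g) (gin g) v w st l k ->
  s' \in FP ->
  2 * #|[set x in FP | lt x s']| <= #|FP| ->
  2 * #|[set x in FP | lt s' x]| <= #|FP| ->
  search_inv lt (gout g) (gin g) v w st' l k /\
  2 * potential lt st' + #|FP| + 2 + 2 * #|BP| <= 2 * potential lt st.
Proof.
move=> st st' inv s'P med1 med2.
split; first by apply: threshold_inv s'P; apply: discard_inv inv _.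
rewrite /potential /=.
have := threshold_potential s s'P med1 med2.
have := half_potential_discard (flip lt) BA BP s s'.
card_lia.
Qed.

End Moves.

(** * Amortized weight of one iteration *)

Definition trace_weight (tr : seq op) : nat := \sum_(o <- tr) weight o.

Lemma trace_weight_cat t1 t2 :
  trace_weight (t1 ++ t2) = trace_weight t1 + trace_weight t2.
Proof. exact: big_cat. Qed.

Lemma trace_weight_cons o t : trace_weight (o :: t) = weight o + trace_weight t.
Proof. exact: big_cons. Qed.

Lemma trace_weight_nil : trace_weight [::] = 0.
Proof. exact: big_nil. Qed.

Lemma trace_weight_nseq m o : trace_weight (nseq m o) = m * weight o.
Proof. by rewrite /trace_weight big_nseq iter_addn_0 mulnC. Qed.

Definition trace_weightE :=
  (trace_weight_cat, trace_weight_cons, trace_weight_nil, trace_weight_nseq).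

Lemma threshold_ops_weight (S1 S2 : {set V}) :
  trace_weight (threshold_ops S1 S2) = #|S1| + 3 * #|S2| + 2.
Proof. rewrite /threshold_ops !trace_weightE; card_lia. Qed.

Section Iteration.

Variables (g : graph n) (v w : V).
Hypothesis amb : ambient (before (gord g)) (gout g) (gin g) v w.

Notation inv := (search_inv (before (gord g)) (gout g) (gin g) v w).
Notation pot := (potential (before (gord g))).

(** One unit of potential pays for weight 8: a new threshold frees half a unit per choice, which
    covers the weight 3 spent on it, and one unit per emptied vertex. The last claim holds because
    the new threshold is itself reactivated. *)
Lemma adjustF_inv st ops st' l k :
  inv st l k -> adjustF (@is_median n) (gord g) st ops st' ->
  [/\ inv st' l k, trace_weight ops + 8 * pot st' <= 1 + 8 * pot st
    & fA st' = set0 -> fP st' = set0].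
Proof.
move=> inv0 adj; case: adj inv0 => {st ops st'}.
- move=> st /eqP A0 inv0; split=> //.
  by rewrite !trace_weightE; card_lia.
- move=> F B BA BP o i s inv0; have [inv1 p1] := close_inv amb inv0.
  by split=> //; move: p1; rewrite !trace_weightE; card_lia.
- move=> F B BA FP BP o i s s' s'P /and3P[_ m1 m2] inv0.
  have [inv1 p1] := retarget_inv amb inv0 s'P m1 m2.
  split=> //; first by move: p1; rewrite threshold_ops_weight; card_lia.
  move=> /setP/(_ s'); rewrite /= !inE s'P.
  by rewrite (strict_irr (amb_order amb)).
Qed.

Lemma adjustB_inv st ops st' l k :
  inv st l k -> (fA st = set0 -> fP st = set0) ->
  adjustB (@is_median n) (gord g) st ops st' ->
  [/\ inv st' l k, trace_weight ops + 8 * pot st' <= 1 + 8 * pot st,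
      fA st' = set0 -> fP st' = set0 & bA st' = set0 -> bP st' = set0].
Proof.
move=> inv0 f0 adj; have amb' := ambient_mirror amb.
case: adj inv0 f0 => {st ops st'}.
- move=> st /eqP A0 inv0; split=> //.
  by rewrite !trace_weightE; card_lia.
- move=> F B FA FP o i s inv0 _.
  have [inv1 p1] := @close_inv _ (mirror_graph g) _ _ amb' _ _ _ _ _ _ _ _ _
                      (search_inv_mirror inv0).
  split=> //; first exact: search_inv_mirror inv1.
  have := potential_mirror (before (gord g)) (Search F B FA set0 FP set0 o i s).
  have := potential_mirror (before (gord g)) 
             (Search F B (FA :\ s) set0 set0 set0 o i s).
  by move: p1; rewrite !trace_weightE /mirror; card_lia.
- move=> F B FA FP BP o i s s' s'P /and3P[_ m1 m2] inv0 _.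
  have [inv1 p1] := @retarget_inv _ (mirror_graph g) _ _ amb' _ _ _ _ _ _ _ _ _ _ _
                      (search_inv_mirror inv0) s'P m2 m1.
  split=> //; first exact: search_inv_mirror inv1.
    have := potential_mirror (before (gord g)) (Search F B FA set0 FP BP o i s).
    have := potential_mirror (before (gord g)) 
      (Search F B (FA :\ s) [set x in BP | ~~ before (gord g) x s']
              set0 [set x in BP | before (gord g) x s'] o i s').
    by move: p1; rewrite threshold_ops_weight /mirror; card_lia.
  move=> /setP/(_ s'); rewrite /= !inE s'P.
  by rewrite (strict_irr (amb_order amb)).
Qed.

Lemma park_mirror st u z :
  mirror (park (gord g) st u z) =
  park_out (flip (before (gord g)))
    (mirror (park_out (before (gord g)) st u)) z.
Proof. by case: st. Qed.

(* Each entry pairs an arc (u, x) traversed forward with an arc (y, z)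
   traversed backward in the same step, the latter stored as (z, y). *)
Definition compatible (L : seq ((V * V) * (V * V))) : bool :=
  all (fun p => before (gord g) p.1.1 p.2.1) L.

(** A traversal raises the potential by at most 4 on each side, and 8 * 8 + 2 + 3 <= 70. Parking has
    weight 4 and lowers the potential by at least 1, and 4 + 3 <= 8. The spare 3 is for the loop
    test and the constant part of the two adjustments. *)
Lemma body_inv st ops st1 L :
  inv st (unzip1 L) (unzip2 L) -> compatible L ->
  body g st ops (Some st1) ->
  exists2 L', inv st1 (unzip1 L') (unzip2 L') /\ compatible L' &
    trace_weight ops + 8 * pot st1 + 70 * size L + 3 <= 8 * pot st + 70 * size L'.
Proof.
move=> inv0 comp bd; have amb' := ambient_mirror amb.
inversion_clear bd as [|u z x y ou iz uA zA uz oE iE cyc|u z uA zA uz].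
  move: cyc; rewrite negb_or !inE => /andP[xB] /norP[yx yF].
  have [inv1 p1] := advance_out_inv amb inv0 uA oE xB.
  have zA1 : z \in fA (mirror (advance_out g st u x ou)).
    by move: zA; case: (st) => *; rewrite /advance_out; case: ifP.
  have iE1 : outp (mirror (advance_out g st u x ou)) z = y :: iz.
    by move: iE; case: (st) => *; rewrite /advance_out; case: ifP.
  (* That y differs from x matters here, since the forward half may just have put x into F. *)
  have yF1 : y \notin bS (mirror (advance_out g st u x ou)).
    move: yF; case: (st) => F *; rewrite /advance_out; case: ifP => //= _.
    by rewrite !inE negb_or yx.
  have [inv2] := @advance_out_inv _ (mirror_graph g) _ _ amb' _ _ _ _ _ _
                   (search_inv_mirror inv1) zA1 iE1 yF1.
  rewrite -(advance_in_mirror g) in inv2 * => p2.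
  exists (((u, x), (z, y)) :: L); last first.
    move: p1 p2; rewrite !potential_mirror !trace_weightE; card_lia.
  split; last by rewrite /compatible /= uz.
  by rewrite -[advance_in _ _ _ _ _]mirrorK; exact: search_inv_mirror inv2.
have [inv1 p1] := park_out_inv amb inv0 uA.
have zA1 : z \in fA (mirror (park_out (before (gord g)) st u)).
  by move: zA; case: (st).
have [inv2] := @park_out_inv _ (mirror_graph g) _ _ amb' _ _ _ _
                 (search_inv_mirror inv1) zA1.
rewrite -park_mirror in inv2 * => p2.
exists L.
  by rewrite -[park _ _ _ _]mirrorK; split; first exact: search_inv_mirror inv2.
(* F and B are disjoint, so z < u; if neither vertex were parked, then u <= s <= z. *)
have moved : 0 < before (gord g) (thr st) u +
                 flip (before (gord g)) (thr (mirror (park_out (before (gord g)) st u))) z.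
  have uF : u \in fS st by apply: (subsetP (h_A (s_F inv0))).
  have zB : z \in bS st by apply: (subsetP (h_A (s_B inv0))).
  have uz_ne : u != z by apply: contraTneq zB => <-; apply: (s_dis inv0).
  have [irr ltt tot] := amb_order amb.
  have zu : before (gord g) z u.
    by have := tot u z; rewrite (negPf uz_ne) (negPf uz).
  have -> : thr (mirror (park_out (before (gord g)) st u)) = thr st by case: (st).
  rewrite /flip; case: (before _ _ u) / idP => // su; case: (before _ z _) / idP => // zs.
  exfalso.
  have := tot (thr st) u; rewrite (negPf (introN idP su)) /= => /orP[/eqP eu|us].
    by apply: zs; rewrite eu.
  by apply: zs; apply: ltt us.
move: p1 p2 moved; rewrite !potential_mirror !trace_weightE.
case: (before _ _ u) => /=; case: (flip _ _ z); card_lia.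
Qed.

End Iteration.
End SearchInvariant.

(** * Related pairs of arcs *)

(* For any two entries (e, f) and (e', f') of L, [ra e < rb f'] or
   [ra e' < rb f]: so at least half of the pairs of entries cross. *)
Lemma crossing_pairs (A B : finType) (ra : A -> nat) (rb : B -> nat)
    (L : seq (A * B)) :
  uniq (unzip1 L) -> uniq (unzip2 L) -> all (fun p => ra p.1 < rb p.2) L ->
  size L ^ 2 <=
    2 * #|[set q | [&& q.1 \in unzip1 L, q.2 \in unzip2 L & ra q.1 < rb q.2]]|.
Proof.
move=> u1 u2 /allP lt; set Q := [set q | _].
pose k := size L; pose t := tnth (in_tuple L).
pose P := [set ij : 'I_k * 'I_k | ra (t ij.1).1 < rb (t ij.2).2].
have tL i : t i \in L by exact: mem_tnth.
have cover : [set: 'I_k * 'I_k] \subset P :|: (fun ij => (ij.2, ij.1)) @: P.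
  apply/subsetP => -[i j] _; rewrite !inE /=.
  (* If [ra e_i >= rb f_j], then [ra e_j < rb f_j <= ra e_i < rb f_i], so the swapped pair
     crosses. *)
  case: ltnP => //= ge; apply/imsetP; exists (j, i) => //; rewrite inE /=.
  by rewrite (leq_trans (lt _ (tL j))) // (leq_trans ge) // ltnW // lt.
have sizeP : k ^ 2 <= 2 * #|P|.
  have := subset_leq_card cover; rewrite cardsT card_prod card_ord => /leq_trans.
  apply; rewrite (leq_trans (leq_card_setU _ _)) // mul2n -addnn leq_add2l.
  exact: leq_imset_card.
apply: leq_trans sizeP _; rewrite leq_mul2l /=.
pose h (ij : 'I_k * 'I_k) := ((t ij.1).1, (t ij.2).2).
have hinj : injective h.
  have inj (C : eqType) (f : A * B -> C) : uniq (map f L) -> injective (f \o t).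
    move=> uf i j /= eij; apply/val_inj => /=.
    have sz (a : 'I_k) : a < size (map f L) by rewrite size_map.
    apply/eqP; rewrite -(nth_uniq (f (t i)) (sz i) (sz j) uf).
    rewrite !(nth_map (t i)) ?ltn_ord // -!(tnth_nth (t i) (in_tuple L)).
    exact/eqP.
  move=> [i j] [i' j'] [e1 e2].
  by congr (_, _); [apply: inj u1 _ _ e1 | apply: inj u2 _ _ e2].
rewrite -(card_imset _ hinj); apply/subset_leq_card/subsetP => _ /imsetP[ij ijP ->].
by move: ijP; rewrite !inE /= !map_f.
Qed.

Section Graphs.

Variable n : nat.
Notation V := 'I_n.
Implicit Types (ord : seq V) (E : seq (V * V)).

Definition related E : {set (V * V) * (V * V)} :=
  [set p | [&& p.1 \in E, p.2 \in E &
               connect (fun x y => (x, y) \in E) p.1.2 p.2.1]].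

Lemma card_related E : #|related E| <= size E ^ 2.
Proof.
have: related E \subset setX [set e in E] [set e in E].
  by apply/subsetP=> p; rewrite !inE => /and3P[-> ->].
move/subset_leq_card/leq_trans; apply; rewrite cardsX leq_mul //;
  by rewrite cardsE card_size.
Qed.

Lemma related_sub E E' : {subset E <= E'} -> related E \subset related E'.
Proof.
move=> sub; apply/subsetP=> p; rewrite !inE => /and3P[/sub-> /sub->] /=.
by apply: connect_sub => x y /sub; exact: connect1.
Qed.

Lemma before_strict_total ord :
  perm_eq ord (enum V) -> strict_total (before ord).
Proof.
move=> po; have mem x : x \in ord by rewrite (perm_mem po) mem_enum.
split=> [x|y x z|x y]; first exact: ltnn.
  exact: ltn_trans.
rewrite /before -neq_ltn; case: eqVneq => //= ne.
by apply: contra ne => /eqP/(index_inj x (mem x) (mem y))->.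
Qed.

Definition topological ord E := forall x y, (x, y) \in E -> before ord x y.

Lemma connect_before ord E x y :
  topological ord E -> connect (fun x y => (x, y) \in E) x y ->
  index x ord <= index y ord.
Proof.
move=> topo /connectP[p pth ->] {y}; elim: p x pth => //= y p IH x /andP[xy /IH].
by apply: leq_trans; apply: ltnW; apply: topo.
Qed.

Record represents (g : graph n) E : Prop := Represents {
  rep_ord : perm_eq (gord g) (enum V);
  rep_out : forall x y, (y \in gout g x) = ((x, y) \in E);
  rep_in : forall x y, (x \in gin g y) = ((x, y) \in E);
  rep_uout : forall x, uniq (gout g x);
  rep_uin : forall x, uniq (gin g x) }.

Lemma perm_insert_at i x (s : seq V) : perm_eq (insert_at i x s) (x :: s).
Proof.
by rewrite /insert_at -cat_rcons -cats1 perm_catAC perm_sym -cat1s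
  -{1}(cat_take_drop i s) perm_catC.
Qed.

Lemma represents_add_arc g E v w i j :
  represents g E -> (v, w) \notin E ->
  represents (add_arc g v w i j) (rcons E (v, w)).
Proof.
case=> po ro ri uo ui vwE; split=> //= [x y|x y|x|x].
- rewrite mem_rcons inE xpair_eqE; case: (eqVneq x v) => [->|_] //=.
  by rewrite (perm_mem (perm_insert_at _ _ _)) inE ro.
- rewrite mem_rcons inE xpair_eqE andbC; case: (eqVneq y w) => [->|_] //=.
  by rewrite (perm_mem (perm_insert_at _ _ _)) inE ri.
- case: (eqVneq x v) => // _; rewrite (perm_uniq (perm_insert_at _ _ _)) /=.
  by rewrite ro vwE uo.
- case: (eqVneq x w) => // _; rewrite (perm_uniq (perm_insert_at _ _ _)) /=.
  by rewrite ri vwE ui.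
Qed.

Lemma represents_ambient g E v w :
  represents g (rcons E (v, w)) -> topological (gord g) E ->
  ambient (before (gord g)) (gout g) (gin g) v w.
Proof.
case=> po ro ri uo ui topo; split=> // [|x y|x y].
- exact: before_strict_total.
- by rewrite ro ri.
- by rewrite ro mem_rcons inE => /orP[->//|/topo].
Qed.

(* The new arc (v, w) relates (y, z) to (u, x) whenever z reaches v and w
   reaches u; if u < z they were not related before, the order being
   topological. *)
Lemma search_relates g E v w st L :
  represents g (rcons E (v, w)) -> topological (gord g) E ->
  search_inv (before (gord g)) (gout g) (gin g) v w st (unzip1 L) (unzip2 L) ->
  compatible g L ->
  2 * #|related E| + size L ^ 2 <= 2 * #|related (rcons E (v, w))|.
Proof.
move=> rep topo inv comp; set E' := rcons E (v, w).
have := @crossing_pairs _ _ (fun e => index e.1 (gord g)) (fun f => index f.1 (gord g))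
          L (h_uniq (s_F inv)) (h_uniq (s_B inv)) comp.
set Q := [set q | _].
(* The backward arc, stored as (z, y), is turned back into (y, z) and put first. *)
pose h (q : (V * V) * (V * V)) := ((q.2.2, q.2.1), q.1).
have hinj : injective h by move=> [[a b] [c d]] [[a' b'] [c' d']] [-> -> -> ->].
have conn : connect (grel (gout g)) =2 connect (fun x y => (x, y) \in E').
  by apply: eq_connect => x y; rewrite /= (rep_out rep).
have sub : related E :|: h @: Q \subset related E'.
  rewrite subUset related_sub => [|e eE]; last by rewrite mem_rcons inE eE orbT.
  apply/subsetP => _ /imsetP[[[u x] [z y]] qQ ->]; move: qQ; rewrite !inE /=.
  rewrite (h_mem (s_F inv)) (h_mem (s_B inv)) -conn.
  move=> /and3P[/and3P[uF xo _] /and3P[zB yi _] _].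
  rewrite -(rep_in rep) yi -(rep_out rep) xo /=.
  have zv : connect (grel (gout g)) z v.
    have <- : connect [rel a b | grel (gin g) b a] z v = connect (grel (gout g)) z v.
      by apply: eq_connect => a b /=; rewrite (rep_in rep) (rep_out rep).
    by rewrite connect_rev; exact (h_conn (s_B inv) zB).
  (* The path goes from z to v, along the new arc to w, and on to u. *)
  apply: connect_trans zv (connect_trans (connect1 _) (h_conn (s_F inv) uF)).
  by rewrite /= (rep_out rep) mem_rcons mem_head.
have dis : related E :&: h @: Q = set0.
  apply/setP => p; rewrite !inE; apply/negP => /andP[pE /imsetP[[[u x] [z y]] qQ pe]].
  move: pE qQ; rewrite pe !inE /= => /and3P[_ _ /(connect_before topo)].
  by rewrite leqNgt => /negPf->; rewrite !andbF.
have := subset_leq_card sub; rewrite cardsU dis cards0 subn0 (card_imset _ hinj).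
repeat move: #|_| => ?; move: (size L ^ 2) => ?; lia.
Qed.

(** * Reordering *)

Lemma before_cat (s1 s2 : seq V) x y :
  before (s1 ++ s2) x y =
  if x \in s1 then (y \in s1) ==> before s1 x y
  else (y \notin s1) && before s2 x y.
Proof.
rewrite /before !index_cat; case: ifP => x1; case: ifP => y1 //=.
- by rewrite ltn_addr // index_mem.
- by apply/negbTE; rewrite -leqNgt (leq_trans (index_size _ _)) ?leq_addr.
- by rewrite ltn_add2l.
Qed.

Lemma before_filter (p : pred V) (s : seq V) x y :
  p x -> p y -> before (filter p s) x y = before s x y.
Proof.
move=> px py; rewrite /before; elim: s => //= z s IH.
case: ifP => [pz|npz] /=.
  by case: ifP => _; case: ifP => // _; rewrite !ltnS.
have [zx|_] := eqVneq z x; first by rewrite zx px in npz.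
have [zy|_] := eqVneq z y; first by rewrite zy py in npz.
by rewrite ltnS.
Qed.

Section Relocate.

Variables (ord M : seq V) (k : nat).
Hypotheses (perm_ord : perm_eq ord (enum V)) (uniqM : uniq M).

Let rest := [seq x <- ord | x \notin M].
(** Both cases of the reordering have this form, with M either F_< alone or B_> followed by F_<. *)
Definition relocate := take k rest ++ M ++ drop k rest.

Let uniq_ord : uniq ord.
Proof. by rewrite (perm_uniq perm_ord) enum_uniq. Qed.

Let mem_rest x : (x \in rest) = (x \notin M).
Proof. by rewrite mem_filter (perm_mem perm_ord) mem_enum andbT. Qed.

Let mem_take x : (x \in take k rest) = (x \notin M) && (index x rest < k).
Proof.
case: (boolP (x \in M)) => xM /=.
  by apply/negbTE; apply: contraL xM => /mem_take; rewrite mem_rest.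
by rewrite in_take // mem_rest.
Qed.

Lemma perm_relocate : perm_eq relocate (enum V).
Proof.
have e : perm_eq relocate (M ++ rest).
  by rewrite /relocate perm_catCA cat_take_drop.
apply: uniq_perm (enum_uniq _) _.
  rewrite (perm_uniq e) cat_uniq uniqM filter_uniq // andbT.
  by apply/hasPn => x; rewrite mem_rest.
by move=> x; rewrite (perm_mem e) mem_cat mem_rest orbN mem_enum.
Qed.

Lemma before_relocate_out x y :
  x \notin M -> y \notin M -> before relocate x y = before ord x y.
Proof.
move=> xM yM.
have e : [seq z <- relocate | z \notin M] = rest.
  rewrite !filter_cat (_ : [seq z <- M | z \notin M] = [::]) /=; last first.
    by apply/eqP; rewrite -[_ == _]negbK -has_filter -all_predC; apply/allP => z /= ->.
  rewrite -filter_cat cat_take_drop; apply/all_filterP/allP => z.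
  by rewrite mem_rest.
by rewrite -(@before_filter (fun z => z \notin M)) // e before_filter.
Qed.

Lemma before_relocate_in x y :
  x \in M -> y \in M -> before relocate x y = before M x y.
Proof. by move=> xM yM; rewrite !before_cat !mem_take xM yM. Qed.

Lemma before_relocate_left x y :
  x \notin M -> y \in M -> index x rest < k -> before relocate x y.
Proof. by move=> xM yM xk; rewrite !before_cat !mem_take xM yM xk. Qed.

Lemma before_relocate_right x y :
  x \in M -> y \notin M -> k <= index y rest -> before relocate x y.
Proof.
move=> xM yM yk; rewrite !before_cat !mem_take xM (negPf yM) /= -leqNgt.
by rewrite yk.
Qed.

Lemma index_rest x y : x \notin M -> y \notin M ->
  (index x rest < index y rest) = before ord x y.
Proof. by move=> xM yM; rewrite -[LHS]/(before _ x y) before_filter. Qed.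

End Relocate.

Section Reorder.

Variables (g : graph n) (E : seq (V * V)) (v w : V) (st : search n).
Variables (l k : seq (V * V)).
Hypothesis rep : represents g (rcons E (v, w)).
Hypothesis topo : topological (gord g) E.
Hypothesis inv :
  search_inv (before (gord g)) (gout g) (gin g) v w st l k.
Hypothesis exhausted : (fA st == set0) || (bA st == set0).
Hypothesis fAP : fA st = set0 -> fP st = set0.
Hypothesis bAP : bA st = set0 -> bP st = set0.

Let t := pivot (gord g) st v.
Let FL := f_lt (gord g) st t.
Let BG := b_gt (gord g) st t.
Let amb := represents_ambient rep topo.
Let ord_strict := amb_order amb.

(** A side whose active set is empty has no parked vertices either, so all its vertices with arcs
    left are discarded. *)
Lemma no_compatible_pair u z :
  u \in fS st -> ~~ nilp (outp st u) -> z \in bS st -> ~~ nilp (inp st z) ->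
  ~~ before (gord g) u z.
Proof.
move=> uF uo zB zi; case/orP: exhausted => /eqP A0.
  by apply: (s_dF inv); rewrite ?(fAP A0) ?A0 ?inE.
by apply: (s_dB inv); rewrite ?(bAP A0) ?A0 ?inE.
Qed.

Lemma pivotP :
  (t == v) || (t \in fS st) && ~~ nilp (outp st t) /\
  forall x, x \in fS st -> before (gord g) x t -> outp st x = [::].
Proof.
rewrite /t /pivot; case: arg_minnP => [|x xP xmin]; first by rewrite eqxx.
split=> // y yF yx; apply/nilP; apply: contraTT yx => yo.
by rewrite /before -leqNgt; apply: xmin; rewrite yF yo orbT.
Qed.

Lemma pivot_le : (t == v) || before (gord g) t v.
Proof.
rewrite /t /pivot; case: arg_minnP => [|x xP xmin]; first by rewrite eqxx.
have := strict_cmp ord_strict x v; have := xmin v; rewrite eqxx => /(_ isT).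
by rewrite leqNgt /before => /negPf->; rewrite orbF.
Qed.

Lemma fS_closed x y :
  x \in fS st -> outp st x = [::] -> y \in gout g x -> y \in fS st.
Proof.
move=> xF ox yx; suff: (x, y) \in l by apply: h_head (s_F inv) _ _.
by rewrite (h_mem (s_F inv)) xF yx ox.
Qed.

Lemma bS_closed x y :
  y \in bS st -> inp st y = [::] -> x \in gin g y -> x \in bS st.
Proof.
move=> yB iy xy; suff: (y, x) \in k by apply: h_head (s_B inv) _ _.
by rewrite (h_mem (s_B inv)) yB xy iy.
Qed.

Lemma f_lt_out x : x \in FL -> x \in fS st /\ outp st x = [::].
Proof. by rewrite inE => /andP[xF xt]; split=> //; apply: (pivotP.2). Qed.

(** If t = v, no vertex of B lies after t. Otherwise t is in F and has an arc left, so a vertex of B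
    after t with an arc left would be compatible with it. *)
Lemma b_gt_in y : y \in BG -> y \in bS st /\ inp st y = [::].
Proof.
rewrite inE => /andP[yB ty]; split=> //; apply/nilP; apply: contraTT ty => yi.
case/orP: pivotP.1 => [/eqP ->|/andP[tF to]]; last exact: no_compatible_pair.
have [|yv] := eqVneq y v; first by move=> ->; rewrite (strict_irr ord_strict).
have := h_ge (s_B inv) yB; rewrite (negPf yv) /=.
exact: (strict_asym ord_strict).
Qed.

Lemma sum_degree_le (deg : V -> seq V) (S : {set V}) (l0 : seq (V * V)) :
  (forall x, uniq (deg x)) ->
  (forall x y, x \in S -> y \in deg x -> (x, y) \in l0) ->
  \sum_(x in S) size (deg x) <= size l0.
Proof.
move=> ud sub.
have -> : \sum_(x in S) size (deg x) =
          size [seq (x, y) | x <- enum S, y <- deg x].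
  by rewrite size_allpairs_dep sumnE big_map big_enum.
apply: uniq_leq_size.
  apply: allpairs_uniq_dep; rewrite ?enum_uniq //.
  by move=> [x y] [x' y'] _ _ [-> ->].
move=> p /allpairsPdep[x [y [xS yx ->]]]; apply: sub => //.
by rewrite mem_enum in xS.
Qed.

(** Every arc scanned, out of F_< or into B_>, was traversed, and each of F and B has at most one
    vertex more than its side has traversed arcs. *)
Lemma reorder_weight :
  trace_weight (reorder_ops g st t) <= 16 * size l + 16 * size k + 30.
Proof.
have cF := h_card (s_F inv); have cB := h_card (s_B inv).
have dF : \sum_(x in FL) size (gout g x) <= size l.
  apply: sum_degree_le => [x|x y xFL yx]; first exact: (rep_uout rep).
  have [xF ox] := f_lt_out xFL.
  by rewrite (h_mem (s_F inv)) xF yx ox.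
have dB : \sum_(x in BG) size (gin g x) <= size k.
  apply: sum_degree_le => [x|x y xFL yx]; first exact: (rep_uin rep).
  have [xF ox] := b_gt_in xFL.
  by rewrite (h_mem (s_B inv)) xF yx ox.
have iF : \sum_(x in FL) count (mem FL) (gout g x) <= \sum_(x in FL) size (gout g x).
  by apply: leq_sum => x _; apply: count_size.
have iB : \sum_(x in BG) count (mem BG) (gin g x) <= \sum_(x in BG) size (gin g x).
  by apply: leq_sum => x _; apply: count_size.
have sF : #|FL| <= #|fS st|.
  by apply/subset_leq_card/subsetP => x; rewrite inE => /andP[].
have sB : #|BG| <= #|bS st|.
  by apply/subset_leq_card/subsetP => x; rewrite inE => /andP[].
rewrite /reorder_ops -/FL -/BG !trace_weightE /weight.
move: cF cB dF dB iF iB sF sB.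
repeat move: #|_| => ?; repeat move: (\sum_(_ in _) _) => ?; lia.
Qed.

Hypothesis vwlt : before (gord g) w v.
Variables sF sB : seq V.
Hypotheses (sortF : topo_list g FL sF) (sortB : topo_list g BG sB).

Let mem_sF x : (x \in sF) = (x \in FL).
Proof. by rewrite (perm_mem sortF.1) mem_enum. Qed.

Let mem_sB x : (x \in sB) = (x \in BG).
Proof. by rewrite (perm_mem sortB.1) mem_enum. Qed.

Let uniq_sF : uniq sF.
Proof. by rewrite (perm_uniq sortF.1) enum_uniq. Qed.

Let uniq_sB : uniq sB.
Proof. by rewrite (perm_uniq sortB.1) enum_uniq. Qed.

Let arc_out x y : (x, y) \in rcons E (v, w) -> y \in gout g x.
Proof. by rewrite (rep_out rep). Qed.

Let before_not_f_lt x : x \notin FL -> x \in fS st -> ~~ before (gord g) x t.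
Proof. by rewrite inE negb_and => /orP[/negPf->|]. Qed.

(** F_< goes just after v and contains w. An arc leaving F_< stays in F, so its head is in F_< or
    after t; an arc entering F_< from outside starts at v or before t. *)
Lemma reorder_at_head : t = v ->
  let M := relocate (gord g) sF (index t [seq x <- gord g | x \notin sF]).+1 in
  perm_eq M (enum V) /\ topological M (rcons E (v, w)).
Proof.
move=> tv M; have po := rep_ord rep; split; first exact: perm_relocate.
have vF : v \notin fS st.
  by apply: contraTN (h_root (s_B inv)) => /(s_dis inv).
have tsF : t \notin sF by rewrite mem_sF inE tv (negPf vF).
move=> x y xyE; have xy : (x, y) = (v, w) \/ before (gord g) x y.
  move: xyE; rewrite mem_rcons inE => /orP[/eqP|/topo]; by [left | right].
have [xF|xF] := boolP (x \in sF); have [yF|yF] := boolP (y \in sF).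
- rewrite (before_relocate_in _ po) //; apply: sortF.2; rewrite -?mem_sF //.
  exact: arc_out.
- apply: (before_relocate_right po) => //; rewrite index_rest //.
  move: xF yF; rewrite !mem_sF => /f_lt_out[xS ox] yF.
  have yS := fS_closed xS ox (arc_out xyE).
  have := before_not_f_lt yF yS; have := strict_cmp ord_strict t y.
  case: eqVneq => [ty|_] /=; first by rewrite -ty tv (negPf vF) in yS.
  by move=> /orP[//|->].
- apply: (before_relocate_left po) => //; rewrite ltnS leqNgt index_rest //.
  case: xy => [[-> _]|xy]; first by rewrite tv (strict_irr ord_strict).
  move: yF; rewrite mem_sF inE => /andP[_ yt].
  by apply: (strict_asym ord_strict); apply: (strict_trans ord_strict) yt.
- rewrite (before_relocate_out _ po) //; case: xy => // -[_ yw].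
  move: yF; rewrite mem_sF inE yw (h_root (s_F inv)) /=.
  by rewrite tv vwlt.
Qed.

(** Both blocks go just before t, and v is in B_>. Arcs out of F_< stay in F, hence avoid B_>, and
    arcs into B_> start in B, hence in B_> or before t. Any other arc out of B_> ends in F_< or not
    before t, and any other arc into F_< starts before t. *)
Lemma reorder_inside : t <> v ->
  let M := relocate (gord g) (sB ++ sF)
             (index t [seq x <- gord g | x \notin sB ++ sF]) in
  perm_eq M (enum V) /\ topological M (rcons E (v, w)).
Proof.
move=> tv; have po := rep_ord rep.
have tS : t \in fS st.
  by case/orP: pivotP.1 => [/eqP //|/andP[]].
have tB := s_dis inv tS.
have vt : before (gord g) t v by case/orP: pivot_le => // /eqP.
have vBG : v \in BG by rewrite inE (h_root (s_B inv)).
have tFL : t \notin FL by rewrite inE (strict_irr ord_strict) andbF.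
have tBG : t \notin BG by rewrite inE (negPf tB).
have dis x : x \in FL -> x \notin BG.
  rewrite inE => /andP[_ xt]; rewrite inE negb_and.
  by rewrite (strict_asym ord_strict xt) orbT.
have uniqM : uniq (sB ++ sF).
  rewrite cat_uniq uniq_sF uniq_sB andbT; apply/hasPn => x.
  by rewrite mem_sF mem_sB => /dis.
have memM x : (x \in sB ++ sF) = (x \in BG) || (x \in FL).
  by rewrite mem_cat mem_sB mem_sF.
have tM : t \notin sB ++ sF by rewrite memM (negPf tFL) (negPf tBG).
move=> M; split; first exact: perm_relocate.
move=> x y xyE; have xy : (x, y) = (v, w) \/ before (gord g) x y.
  move: xyE; rewrite mem_rcons inE => /orP[/eqP|/topo]; by [left | right].
have ltt := strict_trans ord_strict.
have [xM|xM] := boolP (x \in sB ++ sF); have [yM|yM] := boolP (y \in sB ++ sF).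
- rewrite (before_relocate_in _ po) // before_cat !mem_sB.
  move: (xM) (yM); rewrite !memM.
  have [xB _|xB /= xF] := boolP (x \in BG).
    have [yB _|//] := boolP (y \in BG).
    by apply: sortB.2 => //; exact: arc_out.
  have [xS ox] := f_lt_out xF.
  have yB : y \notin BG.
    by rewrite inE negb_and (s_dis inv (fS_closed xS ox (arc_out xyE))).
  by rewrite (negPf yB) /= => yF; apply: sortF.2 => //; exact: arc_out.
- apply: (before_relocate_right po) => //; rewrite leqNgt index_rest //.
  move: (xM) yM; rewrite !memM negb_or => + /andP[yB yF].
  case/orP=> [xB|/f_lt_out[xS ox]]; last first.
    exact: before_not_f_lt yF (fS_closed xS ox (arc_out xyE)).
  case: xy => [[_ yw]|xy].
    by apply: before_not_f_lt; rewrite ?yF // yw (h_root (s_F inv)).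
  move: xB; rewrite inE => /andP[_ tx].
  by apply: (strict_asym ord_strict); apply: ltt xy.
- apply: (before_relocate_left po) => //; rewrite index_rest //.
  case: xy => [[xv _]|xy]; first by rewrite xv memM vBG in xM.
  move: (yM) xM; rewrite !memM negb_or => + /andP[xB _].
  case/orP=> [/b_gt_in[yS iy]|]; last by rewrite inE => /andP[_]; apply: ltt.
  have xS : x \in bS st.
    apply: (bS_closed yS iy).
    by rewrite (rep_in rep).
  move: xB; rewrite inE xS /= => tx; have := strict_cmp ord_strict x t.
  rewrite (negPf tx) orbF; case: eqVneq => //= xt.
  by rewrite xt (negPf tB) in xS.
- rewrite (before_relocate_out _ po) //; case: xy => // -[xv _].
  by rewrite memM xv vBG in xM.
Qed.

Lemma reorder_correct :
  let ord' := reorder (gord g) v t sF sB in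
  perm_eq ord' (enum V) /\ topological ord' (rcons E (v, w)).
Proof.
rewrite /reorder; case: eqP => [tv|tv]; first exact: reorder_at_head.
rewrite (eq_filter (a2 := fun x => x \notin sB ++ sF)) => [|x].
  by have := reorder_inside tv; rewrite /relocate catA.
by rewrite mem_cat negb_or andbC.
Qed.
End Reorder.

(** * Runs of the algorithm *)

Lemma half_inv_init lt (out : V -> seq V) root s :
  uniq (out root) ->
  half_inv lt out root [set root] (if_arcs root (out root)) set0
    [fun _ : V => [::] with root |-> out root] s [::].
Proof.
move=> uo; split=> //=.
- by rewrite inE.
- by rewrite /if_arcs; case: ifP => // _; rewrite sub0set.
- exact: sub0set.
- by move=> x; rewrite inE.
- by move=> x; rewrite inE => ->.
- by move=> x; rewrite inE => /eqP->; apply: connect0.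
- by move=> x; rewrite inE => /eqP->; rewrite eqxx.
- by move=> x; rewrite inE => /eqP->; rewrite eqxx.
- move=> x y; rewrite !inE; case: (eqVneq x root) => //= ->.
  by rewrite andbN.
- by rewrite cards1.
Qed.

Lemma dead_beyond_init lt (out : V -> seq V) root B i :
  dead_beyond lt [set root] (if_arcs root (out root)) set0
    [fun _ : V => [::] with root |-> out root] B i.
Proof.
move=> x z; rewrite inE => /eqP-> /=; rewrite eqxx /if_arcs.
by case: (nilp _) => //; rewrite !inE eqxx.
Qed.

Lemma init_search_inv (g : graph n) v w :
  ambient (before (gord g)) (gout g) (gin g) v w -> v != w ->
  search_inv (before (gord g)) (gout g) (gin g) v w (init_search g v w) [::] [::].
Proof.
move=> amb vw; split=> /=.
- by apply: half_inv_init; apply: amb_uout amb _.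
- by apply: half_inv_init; apply: amb_uin amb _.
- by move=> x; rewrite !inE => /eqP->; rewrite eq_sym.
- exact: dead_beyond_init.
- exact: dead_beyond_init.
Qed.

Lemma half_potential_init lt x (l : seq V) s :
  half_potential lt (if_arcs x l) set0 s <= 4.
Proof.
rewrite /half_potential cards0 minn0.
have : #|if_arcs x l :\ s| <= 1.
  apply: leq_trans (subset_leq_card (subsetDl _ _)) _.
  by rewrite /if_arcs; case: ifP; rewrite ?cards0 ?cards1.
by move: #|_| => a; lia.
Qed.

(** Cauchy-Schwarz, one summand at a time: [(2tk)^2 <= 4 * s * (a * k^2) <= (s + a * k^2)^2] by the
    inequality of the means. *)
Lemma sqr_add_le a s t k :
  t ^ 2 <= a * s -> (t + k) ^ 2 <= a.+1 * (s + k ^ 2).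
Proof.
move=> h; have amgm : 2 * (t * k) <= s + a * k ^ 2.
  rewrite -(@leq_exp2r _ _ 2) //.
  have tk : t ^ 2 * k ^ 2 <= s * (a * k ^ 2).
    by rewrite mulnA [s * a]mulnC leq_mul2r h orbT.
  have := nat_AGM2 s (a * k ^ 2); rewrite -(leq_pmul2l (isT : 0 < 4)) in tk.
  by rewrite !expnMn; apply: leq_trans.
rewrite sqrnD mulnDr ![a.+1 * _]mulSn; move: amgm h.
move: (k ^ 2) (t ^ 2) (t * k) => r q p.
move: (a * r) (a * s) => x y; lia.
Qed.

(* T is the total number of paired traversals of the completed searches, and S
   the sum of the squares of their numbers of traversals. *)
Definition conf_inv (arcs : seq (V * V)) (tr : seq op) (q : config n) : Prop :=
  match q with
  | Idle rest g => exists E T S,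
      [/\ arcs = E ++ rest, represents g E & topological (gord g) E] /\
      [/\ T ^ 2 <= size E * S, S <= 2 * #|related E| &
          trace_weight tr <= 200 * (n + size E + T)]
  | Searching v w rest g st => exists E T S L,
      [/\ arcs = E ++ (v, w) :: rest, represents g (rcons E (v, w)),
          topological (gord g) E & before (gord g) w v] /\
      [/\ search_inv (before (gord g)) (gout g) (gin g) v w st
            (unzip1 L) (unzip2 L),
          compatible g L,
          fA st = set0 -> fP st = set0 & bA st = set0 -> bP st = set0] /\
      [/\ T ^ 2 <= size E * S, S <= 2 * #|related E| &
          trace_weight tr + 8 * potential (before (gord g)) st
            <= 200 * (n + size E + T) + 70 * size L + 66]
  | Halted => exists2 T, T ^ 2 <= 2 * size arcs ^ 3 &
      trace_weight tr <= 200 * (n + 2 * size arcs + T)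
  end.

Lemma cube_bound m E T S :
  size E <= m -> T ^ 2 <= size E * S -> S <= 2 * #|related E| ->
  T ^ 2 <= 2 * m ^ 3.
Proof.
move=> Em TS SE; apply: leq_trans TS _; rewrite expnS mulnCA leq_mul //.
apply: leq_trans SE _; rewrite leq_mul2l /=.
by apply: leq_trans (card_related E) _; rewrite leq_sqr.
Qed.

(** Bounds an unfinished search, whose traversals are not counted in T: the traversed arcs are
    distinct. *)
Lemma search_length g E v w st l k :
  represents g (rcons E (v, w)) ->
  search_inv (before (gord g)) (gout g) (gin g) v w st l k ->
  size l <= (size E).+1.
Proof.
move=> rep inv; rewrite -(size_rcons E (v, w)).
apply: uniq_leq_size (h_uniq (s_F inv)) _ => -[x y].
by rewrite (h_mem (s_F inv)) (rep_out rep) => /and3P[].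
Qed.

(** The current search, if any, adds only O(m), which the factor 2 before [size arcs] absorbs. *)
Lemma conf_inv_halted arcs tr q :
  conf_inv arcs tr q ->
  exists2 T, T ^ 2 <= 2 * size arcs ^ 3 &
    trace_weight tr <= 200 * (n + 2 * size arcs + T).
Proof.
case: q => [rest g|v w rest g st|] //=.
  move=> [E [T [S [[-> _ _] [TS SE W]]]]].
  exists T; last by rewrite size_cat; lia.
  by apply: cube_bound TS SE; rewrite size_cat leq_addr.
move=> [E [T [S [L [[-> rep _ _] [[inv _ _ _] [TS SE W]]]]]]].
exists T; first by apply: cube_bound TS SE; rewrite size_cat leq_addr.
have := search_length rep inv; move: W; move: (potential _ _) => p.
rewrite size_map size_cat /=; lia.
Qed.

Lemma step_inv arcs tr q ops q' : uniq arcs ->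
  conf_inv arcs tr q -> step (@is_median n) q ops q' ->
  conf_inv arcs (tr ++ ops) q'.
Proof.
move=> ua inv stp; move: inv; case: stp => {q ops q'}.
- move=> v w rest g i j vw [E [T [S [[arcsE rep topo] [TS SE W]]]]].
  have vwE : (v, w) \notin E.
    by move: ua; rewrite arcsE uniq_catC /= mem_cat negb_or => /andP[/andP[]].
  exists (rcons E (v, w)), T, S; split; split=> //.
  + by rewrite cat_rcons.
  + exact: represents_add_arc.
  + by move=> x y; rewrite mem_rcons inE => /orP[/eqP[-> ->]|/topo].
  + by rewrite size_rcons (leq_trans TS) // leq_mul2r leqnSn orbT.
  + apply: leq_trans SE _; rewrite leq_mul2l; apply/subset_leq_card/related_sub.
    by move=> e eE; rewrite mem_rcons inE eE orbT.
  + by move: W; rewrite !trace_weightE size_rcons /=; lia.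
- move=> v rest g [E [T [S [[-> _ _] [TS SE W]]]]].
  exists T; first by apply: cube_bound TS SE; rewrite size_cat leq_addr.
  by rewrite !trace_weightE size_cat /=; lia.
- move=> v w rest g i j wv g' [E [T [S [[arcsE rep topo] [TS SE W]]]]].
  have vwE : (v, w) \notin E.
    by move: ua; rewrite arcsE uniq_catC /= mem_cat negb_or => /andP[/andP[]].
  have rep' : represents g' (rcons E (v, w)) by exact: represents_add_arc.
  have amb := represents_ambient rep' topo.
  have vw : v != w.
    by apply: contraTneq wv => ->; rewrite (strict_irr (amb_order amb)).
  exists E, T, S, [::]; split; [by split | split; split=> //]; first exact: init_search_inv.
  rewrite !trace_weightE /potential /=.
  (* The initial potential is at most 4 + 4; with the two operations of the addition this gives 66 =
     8 * 8 + 2. *)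
  have := half_potential_init (before (gord g)) w (gout g' w) v.
  have := half_potential_init (flip (before (gord g))) v (gin g' v) v.
  move: W; repeat move: (half_potential _ _ _ _) => ?; lia.
- move=> v w rest g st ops _ _ bd /=.
  move=> [E [T [S [L [[-> rep _ _] [[inv _ _ _] [TS SE W]]]]]]].
  exists T; first by apply: cube_bound TS SE; rewrite size_cat leq_addr.
  have Wops : trace_weight ops = 2.
    by inversion_clear bd; rewrite !trace_weightE.
  have := search_length rep inv; move: W; move: (potential _ _) => p.
  rewrite !trace_weightE Wops size_map size_cat /=; lia.
- move=> v w rest g st st1 st2 st3 ops1 ops2 ops3 _ _ bd aF aB.
  move=> [E [T [S [L [[arcsE rep topo wv] [[inv comp _ _] [TS SE W]]]]]]].
  have amb := represents_ambient rep topo.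
  have [L' [inv1 comp1] W1] := body_inv amb inv comp bd.
  have [inv2 W2 f2] := adjustF_inv amb inv1 aF.
  have [inv3 W3 f3 b3] := adjustB_inv amb inv2 f2 aB.
  exists E, T, S, L'; split; [by split | split; split=> //].
  move: W W1 W2 W3; rewrite !trace_weightE.
  repeat move: (potential _ _) => ?; repeat move: (trace_weight _) => ?.
  rewrite /=; lia.
- move=> v w rest g st sF sB fin t sortF sortB.
  move=> [E [T [S [L [[arcsE rep topo wv] [[inv comp f0 b0] [TS SE W]]]]]]].
  have rel := search_relates rep topo inv comp.
  have Wr := reorder_weight rep topo inv fin f0 b0.
  have [po topo'] := reorder_correct rep topo inv fin f0 b0 wv sortF sortB.
  exists (rcons E (v, w)), (T + size L), (S + size L ^ 2); split; split=> //.
  + by rewrite cat_rcons.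
  + by case: rep => _ ro ri uo ui; split.
  + by rewrite size_rcons; apply: sqr_add_le.
  + by apply: leq_trans rel; rewrite leq_add2r.
  (* A search costs at most 70 + 32 per traversal and 66 + 30 besides, within the 200 allowed for
     each traversal and for the new arc. *)
  + move: W Wr; rewrite !trace_weightE !size_map size_rcons.
    repeat move: (potential _ _) => ?; repeat move: (trace_weight _) => ?; lia.
Qed.

Lemma run_inv arcs ord tr q :
  uniq arcs -> perm_eq ord (enum V) -> run (@is_median n) arcs ord tr q ->
  conf_inv arcs tr q.
Proof.
move=> ua po; elim=> {tr q} [|tr q ops q' _ IH stp]; last exact: step_inv IH stp.
exists [::], 0, 0; split; split=> //.
by rewrite /setup_ops !trace_weightE /=; lia.
Qed.

End Graphs.

(** * From operation weights to running time and real exponents *)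

Lemma admissible_total c tt :
  admissible c tt -> total_time tt <= c * trace_weight (unzip1 tt).
Proof.
case=> _ other amort; rewrite /total_time /trace_weight big_map.
(* The amortized operations are bounded only in total, the others one by one. *)
rewrite (bigID (fun p => amortized p.1)) [X in c * X](bigID (fun p => amortized p.1)) /=.
rewrite mulnDr leq_add // {amort}; elim: tt other => [|p tt IH] /=.
  by rewrite !big_nil.
case/andP=> pc /IH le; rewrite !big_cons; move: pc; case: (amortized _) => //= pc.
by rewrite mulnDr leq_add.
Qed.

Local Open Scope ring_scope.

Lemma le_powR_three_halves (R : realType) (m : nat) :
  m%:R <= m%:R `^ (3%:R / 2%:R) :> R.
Proof.
case: m => [|m]; first exact: powR_ge0.
rewrite -[leLHS]powRr1 //; apply: ler_powR; first by rewrite ler1n.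
by rewrite ler_pdivlMr ?ltr0n // mul1r ler_nat.
Qed.

Lemma powR_three_halves_ge (R : realType) (m t : nat) :
  (t ^ 2 <= 2 * m ^ 3)%N -> t%:R <= 2 * m%:R `^ (3%:R / 2%:R) :> R.
Proof.
move=> tm; rewrite -(@ler_pXn2r _ 2) ?nnegrE ?mulr_ge0 ?powR_ge0 //.
rewrite exprMn -[X in _ * X]powR_mulrn ?powR_ge0 // -powRrM.
rewrite divfK ?pnatr_eq0 // powR_mulrn // -!natrX -natrM ler_nat.
by apply: leq_trans tm _; rewrite leq_mul2r orbT.
Qed.

(** The condition [n <= k * m] expresses that m is Omega(n). The constant C depends on c and k only,
    and interrupted runs are covered as well. *)
Theorem theorem4p5 (R : realType) (c k : nat) :
  exists C : R, forall (n m : nat) (arcs : seq ('I_n * 'I_n)) (ord : seq 'I_n)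
      (tt : timed_trace) (q : config n),
    uniq arcs -> size arcs = m -> (n <= k * m)%N ->
    perm_eq ord (enum 'I_n) ->
    run (@is_median n) arcs ord (unzip1 tt) q ->
    admissible c tt ->
    (total_time tt)%:R <= C * m%:R `^ (3%:R / 2%:R).
Proof.
(* Here k + 2 comes from n + 2 * m <= (k + 2) * m, and the other 2 from T <= 2 * m^(3/2). *)
exists (c * 200 * (k + 4))%:R => n m arcs ord tt q ua <- nkm po r adm.
have [t tm W] := conf_inv_halted (run_inv ua po r).
have total : (total_time tt <= c * 200 * ((k + 2) * size arcs + t))%N.
  apply: leq_trans (admissible_total adm) _.
  rewrite -mulnA leq_mul2l; apply/orP; right; apply: leq_trans W _.
  by rewrite leq_mul2l /= mulnDl !leq_add.
have := total; rewrite -(ler_nat R) => /le_trans; apply.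
rewrite !natrM -[leRHS]mulrA ler_wpM2l ?mulr_ge0 //.
rewrite (_ : (k + 4 = (k + 2) + 2)%N) ?[in leLHS]natrD; last by rewrite -addnA.
rewrite [in leRHS]natrD.
rewrite [leRHS]mulrDl natrM lerD ?ler_wpM2l //.
- exact: le_powR_three_halves.
- exact: powR_three_halves_ge.
Qed.
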